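(* (Outage capacity in the interference power limited regime, $P_{\max}\to\infty$.) Put $$c_p=\frac{e^{\sigma^2/(P_p\overline q)}\,\Gamma\left(0,\frac{\sigma^2}{P_p\overline q}\right)}{P_p\,\overline q}.$$ For outage threshold $\epsilon$, the asymptotic outage capacity of the secondary user with transmit antenna selection among $N$ antennas is $$C^{\mathrm{IPLR}}_{\mathrm{out}}=\log\left(1+c_p\frac{Q\overline g}{\overline h}N\right)-\log\left(\frac{1+c_p\frac{Q\overline g}{\overline h}Ne}{1+c_p\frac{Q\overline g}{\overline h}N}\right)\log\log\left(\frac1\epsilon\right).$$ Since the factor $\log\left(\frac{1+c_p\frac{Q\overline g}{\overline h}Ne}{1+c_p\frac{Q\overline g}{\overline h}N}\right)$ tends to $1$ as $N\to\infty$, $$C^{\mathrm{IPLR}}_{\mathrm{out}}\approx\log\left(1+c_p\frac{Q\overline g}{\overline h}N\right)-\log\log\left(\frac1\epsilon\right)=C^{\mathrm{IPLR}}-\mathrm E_0-\log\log\left(\frac1\epsilon\right),$$ where $C^{\mathrm{IPLR}}=\log\left(1+c_p\frac{Q\overline g}{\overline h}N\right)+\mathrm E_0$ is the asymptotic mean capacity and $\mathrm E_0=0.5772\ldots$ is the Euler constant. Hence the outage capacity scales in the same manner as the mean capacity (as $\log N$), and for given $\epsilon$ there is a constant gap $\mathrm E_0+\log\log\left(\frac1\epsilon\right)$ between $C^{\mathrm{IPLR}}_{\mathrm{out}}$ and $C^{\mathrm{IPLR}}$.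
   Context: Logarithms are natural, $e$ is their base, and $\Gamma(a,b)=\int_b^\infty e^{-t}t^{a-1}\,dt$. The per-antenna SINR of the secondary user is $\gamma=\min\left\{\frac{Qg}{h(P_pq+\sigma^2)},\frac{P_{\max}g}{P_pq+\sigma^2}\right\}$, where $g,h,q$ are independent exponential random variables with means $\overline g,\overline h,\overline q$, and $Q$ (interference power constraint), $P_{\max}$ (maximum transmit power), $P_p$ (primary transmit power), $\sigma^2$ (noise power) are positive. With antenna selection among $N$ antennas, the per-antenna SINRs are treated as i.i.d. with distribution function $F_\gamma$, and the rate $R_{\max}$ is the maximum of the $N$ per-antenna rates $\log(1+\gamma)$; the outage capacity is the $\epsilon$-quantile of $R_{\max}$, $\epsilon\in(0,1)$, and the mean capacity is $\mathbb E[R_{\max}]$. By extreme value theory the distribution of $R_{\max}$ is approximated for large $N$ by the Gumbel distribution $\exp\left(-e^{-(x-a_N)/b_N}\right)$ with $a_N=\log[1+F_\gamma^{-1}(1-\frac1N)]$ and $b_N=\log\frac{1+F_\gamma^{-1}(1-\frac1{Ne})}{1+F_\gamma^{-1}(1-\frac1N)}$, so that the mean capacity is approximated by $a_N+b_N\mathrm E_0$ and the outage capacity by $a_N-b_N\log\log(1/\epsilon)$. $C^{\mathrm{IPLR}}$ and $C^{\mathrm{IPLR}}_{\mathrm{out}}$ denote the values of these asymptotic approximations when $F_\gamma$ is replaced by its asymptotic form for $P_{\max}\to\infty$, namely $F(x)=1-c_p\frac{Q\overline g}{x\overline h}$ (with, for $C^{\mathrm{IPLR}}$, also $b_N$ replaced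 by its limit $1$). *)

(* Defs.v *)
From mathcomp Require Import all_boot all_order all_algebra.
From mathcomp Require Import all_classical all_reals all_analysis.

Set Implicit Arguments.
Unset Strict Implicit.
Unset Printing Implicit Defensive.

Import Order.TTheory GRing.Theory Num.Theory.
Import numFieldNormedType.Exports.

Local Open Scope classical_set_scope.
Local Open Scope ring_scope.

(* Euler's constant 0.5772... *)
Definition euler_constant (R : realType) : R :=
  limn (fun n : nat => \sum_(1 <= k < n.+1) k%:R^-1 - ln (n%:R : R)).

(* Upper incomplete gamma function, in the argument order Gamma(a, b). *)
Definition upper_gamma (R : realType) (a b : R) : R :=
  \int[@lebesgue_measure R]_(t in `[b, +oo[) (expR (- t) * t `^ (a - 1)).

Section channel.
Context d (T : measurableType d) (R : realType) (P : probability T R).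

(* The library parametrizes the exponential law by its rate, the inverse of
   its mean. *)
Definition exponential_with_mean (X : {RV P >-> R}) (m : R) : Prop :=
  forall A : set R, measurable A -> distribution P X A = exponential_prob m^-1 A.

(* Pairwise factorization is the case where one of the sets is setT. *)
Definition independent3 (X Y Z : {RV P >-> R}) : Prop :=
  forall A B C : set R, measurable A -> measurable B -> measurable C ->
    P (X @^-1` A `&` Y @^-1` B `&` Z @^-1` C) =
    (P (X @^-1` A) * P (Y @^-1` B) * P (Z @^-1` C))%E.

(* sigma2 is the noise power, i.e. sigma^2. *)
Definition sinr (g h q : T -> R) (Q Pmax Pp sigma2 : R) (w : T) : R :=
  Num.min (Q * g w / (h w * (Pp * q w + sigma2)))
          (Pmax * g w / (Pp * q w + sigma2)).

Definition sinr_cdf (g h q : T -> R) (Q Pp sigma2 Pmax x : R) : R :=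
  fine (P [set w | sinr g h q Q Pmax Pp sigma2 w <= x]).

End channel.

(* F is an asymptotic form of the distribution functions G Pmax for
   Pmax -> +oo: their pointwise limit has the same upper tail as F, which is
   the part of the distribution that determines the extreme value constants. *)
Definition asymptotic_form (R : realType) (G : R -> R -> R) (F : R -> R) : Prop :=
  exists Flim : R -> R,
    (forall x : R, G Pmax x @[Pmax --> +oo] --> Flim x) /\
    (1 - Flim x) / (1 - F x) @[x --> +oo] --> (1 : R).

Section extreme_value.
Context (R : realType).

(* Inverse of a distribution function F considered on D. *)
Definition quantile (D : set R) (F : R -> R) (p : R) : R :=
  inf [set x | D x /\ p <= F x].

(* Location a_N and scale b_N of the Gumbel approximation to the law of the
   maximum of N i.i.d. rates log(1 + gamma), where gamma > 0 has
   distribution function F. *)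
Definition gumbel_location (F : R -> R) (N : nat) : R :=
  ln (1 + quantile `]0, +oo[ F (1 - N%:R^-1)).

Definition gumbel_scale (F : R -> R) (N : nat) : R :=
  ln ((1 + quantile `]0, +oo[ F (1 - (N%:R * expR 1)^-1)) /
      (1 + quantile `]0, +oo[ F (1 - N%:R^-1))).

Definition gumbel_cdf (a b x : R) : R := expR (- expR (- ((x - a) / b))).

(* Closed form of the mean of the Gumbel distribution. *)
Definition gumbel_mean (a b : R) : R := a + b * euler_constant R.

Definition gumbel_outage (a b eps : R) : R := quantile setT (gumbel_cdf a b) eps.

End extreme_value.

Section interference_limited.
Context (R : realType).

Definition c_p (Pp sigma2 qbar : R) : R :=
  expR (sigma2 / (Pp * qbar)) * upper_gamma 0 (sigma2 / (Pp * qbar)) /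
  (Pp * qbar).

(* Used only for large x: a distribution function on [c_p Q gbar / hbar, +oo[. *)
Definition F_IPLR (Q Pp sigma2 gbar hbar qbar x : R) : R :=
  1 - c_p Pp sigma2 qbar * (Q * gbar / (x * hbar)).

(* The scale b_N is replaced by its limit 1. *)
Definition C_IPLR (Q Pp sigma2 gbar hbar qbar : R) (N : nat) : R :=
  gumbel_mean (gumbel_location (F_IPLR Q Pp sigma2 gbar hbar qbar) N) 1.

Definition C_IPLR_out (Q Pp sigma2 gbar hbar qbar : R) (eps : R) (N : nat) : R :=
  gumbel_outage (gumbel_location (F_IPLR Q Pp sigma2 gbar hbar qbar) N)
                (gumbel_scale (F_IPLR Q Pp sigma2 gbar hbar qbar) N) eps.

End interference_limited.

(* Main.v *)
From HB Require Import structures.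
From mathcomp Require Import all_boot all_order all_algebra.
From mathcomp Require Import all_classical all_reals all_analysis.
From mathcomp Require Import measurable_realfun.
From mathcomp Require Import ring lra.
Require Import Defs.

Set Implicit Arguments.
Unset Strict Implicit.
Unset Printing Implicit Defensive.

Import Order.TTheory GRing.Theory Num.Theory.
Import numFieldNormedType.Exports.

Local Open Scope classical_set_scope.
Local Open Scope ring_scope.

(** For large [Pmax] the SINR coincides with [Y = Q g / (h (Pp q + sigma2))]
    except on the event [h <= Q / Pmax], whose probability tends to 0. Writing
    [Z = Pp q + sigma2] and [c = hbar / (Q gbar)], conditioning on [q] and [h]
    gives [P(Y > x) = E[1 / (1 + x c Z)]], and
    [0 <= 1 / (x c Z) - 1 / (1 + x c Z) <= 1 / (x c sigma2)^2] shows that this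
    is equivalent to [E[1 / Z] / (x c)]; an affine change of variables
    identifies [E[1 / Z]] with [c_p]. For the distribution function
    [1 - K / x] the quantile at [1 - 1 / y] is [K y], and the capacities are
    then explicit. *)

(** * Integration against a density, and joint laws of independent variables *)

(** The formula [mE] makes [m] absolutely continuous. Its Radon-Nikodym derivative and [p] have the
    same integral over every measurable set, hence agree almost everywhere, and the change of
    variables for the derivative carries over to [p]. *)
Lemma ge0_integral_density (R : realType)
    (m : {finite_measure set (measurableTypeR R) -> \bar R}) (p : R -> R) (f : R -> \bar R) :
  (@lebesgue_measure R).-integrable setT (EFin \o p) ->
  (forall A, measurable A ->
    m A = (\int[@lebesgue_measure R]_(x in A) (p x)%:E)%E) ->
  measurable_fun setT f -> (forall x, (0 <= f x)%E) ->
  (\int[m]_x f x = \int[@lebesgue_measure R]_x (f x * (p x)%:E))%E.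
Proof.
move=> ip mE mf f0.
have mp : measurable_fun setT (EFin \o p) by exact: measurable_int ip.
have dom : m `<< @lebesgue_measure R.
  apply/null_content_dominatesP => A mA muA0; rewrite mE//.
  by apply: null_set_integral => //; exact: measurable_funTS.
rewrite -(Radon_Nikodym_SigmaFinite.change_of_variables dom)//.
have iRN := Radon_Nikodym_SigmaFinite.f_integrable dom.
apply: ae_eq_integral => //.
- by apply: emeasurable_funM => //; exact: measurable_int iRN.
- exact: emeasurable_funM.
- apply: ae_eqe_mul2l; apply: integral_ae_eq => //.
  by move=> E _ mEE; rewrite -Radon_Nikodym_SigmaFinite.f_integral// mE.
Qed.

Lemma measurable_funT_pair d (T : measurableType d) (R : realType)
    (X Y : {mfun T >-> R}) : measurable_fun setT (fun w => (X w, Y w)).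
Proof. by apply/measurable_fun_pairP; split; exact: measurable_funPT. Qed.

Lemma independent3_law12 d (T : measurableType d) (R : realType)
    (P : probability T R) (X Y Z : {RV P >-> R}) (B : set (R * R)) (C : set R) :
  independent3 X Y Z -> measurable B -> measurable C ->
  P ((fun w => (X w, Y w)) @^-1` B `&` Z @^-1` C) =
  ((distribution P X \x distribution P Y) B * P (Z @^-1` C))%E.
Proof.
move=> ind mB mC.
pose XY : {mfun T >-> (R * R)%type} := HB.pack (fun w => (X w, Y w))
  (isMeasurableFun.Build _ _ _ _ _ (measurable_funT_pair X Y)).
have mZC : measurable (Z @^-1` C) by exact: measurable_funPTI.
have PZC_fin : P (Z @^-1` C) \is a fin_num by exact: fin_num_measure.
pose c : {nonneg R} := NngNum (fine_ge0 (measure_ge0 P (Z @^-1` C))).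
have cE : (c%:num%:E = P (Z @^-1` C))%E by rewrite /= fineK.
pose m1 : {sigma_finite_measure set R -> \bar R} := mscale c (distribution P X).
pose m2 : {sigma_finite_measure set R -> \bar R} := distribution P Y.
have mE A1 A2 : measurable A1 -> measurable A2 ->
  pushforward (mrestr P mZC) XY (A1 `*` A2) = (m1 A1 * m2 A2)%E.
  move=> mA1 mA2; rewrite /pushforward/= /mrestr.
  rewrite -[LHS]/(P (X @^-1` A1 `&` Y @^-1` A2 `&` Z @^-1` C)) ind//.
  by rewrite -[X in _ = (X * _)%E]/(c%:num%:E * P (X @^-1` A1))%E cE muleC muleA.
have := @product_measure_unique _ _ _ _ _ m1 m2 _ mE B mB.
rewrite {1}/product_measure1 ge0_integral_mscale//; last exact: measurable_fun_xsection.
by rewrite -[X in (_ * X)%E]/((distribution P X \x distribution P Y)%E B) cE muleC => ->.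
Qed.

(** The previous lemma and uniqueness of the product measure show that the joint law is the product
    of the law of [(X, Y)] and the law of [Z]. The section of the event at [v] is the ray above
    [phi v], and Tonelli splits the remaining integral. *)
Lemma independent3_tail d (T : measurableType d) (R : realType)
    (P : probability T R) (X Y Z : {RV P >-> R}) (phi : R * R -> R) :
  independent3 X Y Z -> measurable_fun setT phi ->
  P [set w | phi (X w, Y w) < Z w] =
  (\int[distribution P X]_x \int[distribution P Y]_y
     distribution P Z `]phi (x, y), +oo[)%E.
Proof.
move=> ind mphi.
have mXY := measurable_funT_pair X Y.
pose XY : {mfun T >-> (R * R)%type} := HB.pack (fun w => (X w, Y w))
  (isMeasurableFun.Build _ _ _ _ _ mXY).
have mXYZ : measurable_fun setT (fun w => ((X w, Y w), Z w)).
  by apply/measurable_fun_pairP; split; last exact: measurable_funPT.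
pose XYZ : {mfun T >-> (R * R * R)%type} := HB.pack (fun w => ((X w, Y w), Z w))
  (isMeasurableFun.Build _ _ _ _ _ mXYZ).
have law12 B : measurable B ->
    distribution P XY B = (distribution P X \x distribution P Y)%E B.
  move=> mB; have := independent3_law12 ind mB measurableT.
  by rewrite preimage_setT setIT probability_setT mule1.
pose E : set (R * R * R) := [set u | phi u.1 < u.2].
have mE : measurable E.
  have : measurable_fun setT (fun u : R * R * R => phi u.1 < u.2).
    by apply: measurable_fun_ltr => //; exact: measurableT_comp.
  by move=> /(_ measurableT [set true]); rewrite setTI; exact.
pose m1 : {sigma_finite_measure set (R * R)%type -> \bar R} := distribution P XY.
pose m2 : {sigma_finite_measure set R -> \bar R} := distribution P Z.
have mXYZE A1 A2 : measurable A1 -> measurable A2 ->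
    distribution P XYZ (A1 `*` A2) = (m1 A1 * m2 A2)%E.
  move=> mA1 mA2; rewrite /m1 /= law12//.
  by rewrite -[RHS](independent3_law12 ind).
transitivity (distribution P XYZ E) => //.
rewrite -(@product_measure_unique _ _ _ _ _ m1 m2 _ mXYZE)//.
have sE v : xsection E v = `]phi v, +oo[%classic.
  by apply/seteqP; split => z /=; rewrite /xsection/= inE/= in_itv/= andbT.
have mtail : measurable_fun setT (fun v => distribution P Z `]phi v, +oo[).
  have := measurable_fun_xsection m2 mE.
  by apply: eq_measurable_fun => v _ /=; rewrite sE.
pose mX : {sigma_finite_measure set R -> \bar R} := distribution P X.
pose mY : {sigma_finite_measure set R -> \bar R} := distribution P Y.
rewrite /product_measure1.
transitivity (\int[mX \x mY]_v distribution P Z `]phi v, +oo[)%E.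
  transitivity (\int[m1]_v distribution P Z `]phi v, +oo[)%E.
    by apply: eq_integral => v _ /=; rewrite sE.
  by apply: eq_measure_integral => A mA _; exact: law12.
by rewrite (fubini_tonelli1 (fun v => distribution P Z `]phi v, +oo[)%E).
Qed.

(** * The exponential law: integrals, tail and Laplace transform *)

Section exponential_law.
Context d (T : measurableType d) (R : realType) (P : probability T R).
Variables (X : {RV P >-> R}) (m : R).
Hypotheses (m_gt0 : 0 < m) (X_exp : exponential_with_mean X m).
Local Notation mu := (@lebesgue_measure R).

Lemma exponential_law_integral (f : R -> \bar R) :
  measurable_fun setT f -> (forall x, (0 <= f x)%E) ->
  (\int[distribution P X]_x f x =
   \int[mu]_x (f x * (exponential_pdf m^-1 x)%:E))%E.
Proof.
move=> mf f0.
(* [lebesgue_measure] lives on [measurableTypeR R], which does not unify with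
   [R] as a measurable type: the law is transported along the identity. *)
have mid : measurable_fun setT (idfun : R -> measurableTypeR R).
  exact: measurable_id.
pose id' : {mfun R >-> measurableTypeR R} := HB.pack (idfun : R -> measurableTypeR R)
  (isMeasurableFun.Build _ _ _ _ _ mid).
pose mX : {finite_measure set (measurableTypeR R) -> \bar R} :=
  distribution (distribution P X) id'.
rewrite -(@ge0_integral_density _ mX)//.
  by rewrite [RHS]ge0_integral_distribution.
by apply: integrable_exponential_pdf; rewrite invr_gt0.
Qed.

Lemma exponential_law_tail (y : R) : 0 <= y ->
  distribution P X `]y, +oo[ = (expR (- (y / m)))%:E.
Proof.
move=> y0; rewrite X_exp// /exponential_prob.
have mp : measurable_fun setT (exponential_pdf m^-1).
  exact: measurable_exponential_pdf.
rewrite integral_itv_obnd_cbnd; last first.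
  by apply/measurable_EFinP; exact: measurable_funTS.
have cexp : continuous (fun z : R^o => expR (- m^-1 * z)).
  move=> z; apply: continuous_comp; last exact: continuous_expR.
  by apply: continuousM => //; apply: (@continuousN _ R^o); exact: cst_continuous.
(* On the ray above [y >= 0] the density has this antiderivative, which tends to 0 at infinity. *)
rewrite (@ge0_continuous_FTC2y _ _ (fun x => - (expR (- m^-1 * x))) _ 0)//.
- by rewrite EFinN oppeK add0e mulNr [(m^-1 * y)]mulrC.
- by move=> x _; apply: exponential_pdf_ge0; rewrite invr_ge0 ltW.
- apply: (@continuous_subspaceW R^o _ _ [set` `[0, +oo[%R]).
    by apply: subset_itvr; rewrite bnd_simp.
  exact: within_continuous_exponential_pdf.
- rewrite -oppr0; apply: cvgN.
  rewrite (_ : (fun x => expR (- m^-1 * x)) =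
               (fun z => expR (- z)) \o (fun z => m^-1 * z)); last first.
    by apply: eq_fun => x; rewrite mulNr.
  apply: (@cvg_comp _ _ _ _ _ _ (pinfty_nbhs R)); last exact: cvgr_expR.
  by apply: gt0_cvgMry; rewrite ?invr_gt0//; exact: cvg_id.
- by apply: cvgN; apply/cvg_at_right_filter; exact: cexp.
- move=> x; rewrite in_itv/= andbT => yx.
  by apply: derive1_exponential_pdf; rewrite in_itv/= andbT (le_lt_trans y0).
Qed.

Lemma exponential_law_le (y : R) : 0 <= y ->
  P [set w | X w <= y] = (1 - expR (- (y / m)))%:E.
Proof.
move=> y0; have mA : measurable (X @^-1` `]y, +oo[) by exact: measurable_funPTI.
rewrite (_ : [set w | X w <= y] = ~` (X @^-1` `]y, +oo[)); last first.
  by apply/seteqP; split => w /=; rewrite in_itv/= andbT leNgt => /negP.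
rewrite probability_setC//.
by rewrite -[P _]/(distribution P X `]y, +oo[) exponential_law_tail.
Qed.

(** Multiplying the density of rate [m^-1] by [expR (- (s * x))] gives the density of rate
    [m^-1 + s] up to the factor [(1 + s * m)^-1], and that density has total mass 1. The absolute
    value changes nothing where the density is nonzero. *)
Lemma exponential_law_laplace (s : R) : 0 <= s ->
  (\int[distribution P X]_x (expR (- (s * `|x|)))%:E = ((1 + s * m)^-1)%:E)%E.
Proof.
move=> s0.
have sm0 : 0 < 1 + s * m by rewrite ltr_pwDl// mulr_ge0// ltW.
have mr0 : 0 < m^-1 + s by rewrite ltr_pwDl// invr_gt0.
rewrite exponential_law_integral//; last first.
  apply/measurable_EFinP; do 2 apply: measurableT_comp => //.
  exact: measurable_funM.
transitivity (\int[mu]_x (((1 + s * m)^-1)%:E * (exponential_pdf (m^-1 + s) x)%:E))%E.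
  apply: eq_integral => x _; rewrite -!EFinM; congr (_%:E).
  have [x0|x0] := leP 0 x; last first.
    by rewrite !lt0_exponential_pdf// !mulr0.
  rewrite !exponential_pdfE// ger0_norm// mulrCA -expRD mulrA; congr (_ * expR _).
    by field; rewrite !gt_eqF.
  by ring.
rewrite ge0_integralZl//.
- by rewrite integral_exponential_pdf// mule1.
- by apply/measurable_EFinP; exact: measurable_exponential_pdf.
- by move=> x _; rewrite lee_fin exponential_pdf_ge0// ltW.
- by rewrite lee_fin invr_ge0 ltW.
Qed.

End exponential_law.

(** The inverse is rewritten through a real power of a square, whose measurability is known. At 0
    both expressions are 0, by the convention for [0^-1]. *)
Lemma measurable_inv (R : realType) : measurable_fun setT (@GRing.inv R).
Proof.
have -> : @GRing.inv R = (fun x => x * (x ^+ 2) `^ (-1)).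
  apply/funext => x; rewrite powR_inv1 ?sqr_ge0//.
  have [->|x0] := eqVneq x 0; first by rewrite invr0 mul0r.
  by field.
apply: measurable_funM => //.
apply: (@measurableT_comp _ _ _ _ _ _ (fun a => a `^ (-1))) => //.
Qed.

(** Used in both directions to compare two events that coincide outside a null or small event
    [N]. *)
Lemma measure_leU2 d (T : measurableType d) (R : realType)
    (P : {measure set T -> \bar R}) (A B N : set T) :
  measurable A -> measurable B -> measurable N -> A `<=` B `|` N ->
  (P A <= P B + P N)%E.
Proof.
move=> mA mB mN AB; apply: (@le_trans _ _ (P (B `|` N))); last exact: measureU2.
by apply: le_measure => //; rewrite inE//; exact: measurableU.
Qed.

(** * The mean of [1 / Z] and the constant [c_p] *)

Section inverse_affine_mean.
Context d (T : measurableType d) (R : realType) (P : probability T R).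
Variables (X : {RV P >-> R}) (m Pp sigma2 : R).
Hypotheses (m_gt0 : 0 < m) (X_exp : exponential_with_mean X m).
Hypotheses (Pp_gt0 : 0 < Pp) (sigma2_gt0 : 0 < sigma2).
Local Notation mu := (@lebesgue_measure R).
Let Z (v : R) := Pp * `|v| + sigma2.

Let Z_gt0 v : 0 < Z v.
Proof. by rewrite ltr_wpDl// mulr_ge0// ltW. Qed.

Let mZV : measurable_fun setT (fun v => (Z v)^-1).
Proof.
apply: measurableT_comp; first exact: measurable_inv.
by apply: measurable_funD => //; exact: measurable_funM.
Qed.

Lemma exponential_mean_inv_ge :
  (((sigma2 + Pp * m)^-1)%:E <= \int[distribution P X]_v ((Z v)^-1)%:E)%E.
Proof.
have s0 : 0 <= Pp / sigma2 by rewrite divr_ge0// ltW.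
(* [1 + y <= expR y] bounds [1 / Z] below by a Laplace transform *)
have := exponential_law_laplace m_gt0 X_exp s0.
set I := (X in X = _) => IE.
have -> : ((sigma2 + Pp * m)^-1)%:E = (sigma2^-1%:E * I)%E.
  by rewrite IE -EFinM; congr (_%:E); field; rewrite !gt_eqF// ltr_pwDl// mulr_ge0// ltW.
rewrite /I -ge0_integralZl//; last 2 first.
- do 3 apply: measurableT_comp => //.
  exact: measurable_funM.
- by rewrite lee_fin invr_ge0 ltW.
apply: ge0_le_integral => //.
- by move=> v _; rewrite -EFinM lee_fin mulr_ge0 ?expR_ge0// invr_ge0 ltW.
- apply: measurable_funeM; do 3 apply: measurableT_comp => //.
  exact: measurable_funM.
- exact/measurable_EFinP.
- move=> v _; rewrite -EFinM lee_fin expRN -invfM lef_pV2 ?posrE//; last first.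
    by rewrite mulr_gt0// expR_gt0.
  have -> : Z v = sigma2 * (1 + Pp / sigma2 * `|v|) by rewrite /Z; field; rewrite gt_eqF.
  by rewrite ler_pM2l// expR_ge1Dx.
Qed.

Lemma exponential_mean_inv_le :
  (\int[distribution P X]_v ((Z v)^-1)%:E <= sigma2^-1%:E)%E.
Proof.
apply: (@le_trans _ _ (\int[distribution P X]_v (sigma2^-1)%:E)%E).
  apply: ge0_le_integral => //.
  - by move=> v _; rewrite lee_fin invr_ge0 ltW.
  - exact/measurable_EFinP.
  - by move=> v _; rewrite lee_fin lef_pV2 ?posrE// lerDr mulr_ge0// ltW.
by rewrite integral_cst//= probability_setT mule1.
Qed.

(** The substitution [t = v / m + b] with [b = sigma2 / (Pp * m)] works because [Z v = Pp * m * t]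
    for [v >= 0]: the mean turns into the integral of [expR (- t) / t] over [t >= b], which is
    [upper_gamma 0 b]. *)
Lemma exponential_mean_inv :
  (\int[distribution P X]_v ((Z v)^-1)%:E = (c_p Pp sigma2 m)%:E)%E.
Proof.
set I := (X in X = _).
have I_fin : I \is a fin_num.
  rewrite ge0_fin_numE; last first.
    by apply: integral_ge0 => v _; rewrite lee_fin invr_ge0 ltW.
  by rewrite (le_lt_trans exponential_mean_inv_le)// ltry.
set b := sigma2 / (Pp * m).
have b0 : 0 < b by rewrite divr_gt0// mulr_gt0.
pose F x : R := m^-1 * x + b.
have cF : continuous F.
  by move=> x; apply: differentiable_continuous; apply/derivable1_diffP; exact: ex_derive.
have Fy : F x @[x --> +oo] --> +oo.
  apply/cvgryPge => A; exists (m * (A - b)); split; first exact: num_real.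
  by move=> x /ltW Ax; rewrite /F -lerBlDr ler_pdivlMl.
pose G (t : R) : R := expR (- t) * t^-1.
have F0 : F 0 = b by rewrite /F mulr0 add0r.
have dF : derive1 F = cst m^-1.
  apply/funext => x; rewrite derive1E /F.
  by rewrite derive_val scaler1 addr0.
(* Here [F] maps the half-line from 0 onto the half-line from [b]. The factor [expR (- b)] comes
   from the shift in the exponential, and [Pp * m] from [Z v = Pp * m * F v]. *)
have key : (\int[mu]_(t in `[b, +oo[) (G t)%:E = (expR (- b) * (Pp * m))%:E * I)%E.
  rewrite -[in LHS]F0 increasing_ge0_integration_by_substitutiony//.
  - rewrite dF /I (exponential_law_integral m_gt0 X_exp)//; last 2 first.
    + exact/measurable_EFinP.
    + by move=> x; rewrite lee_fin invr_ge0 ltW.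
    rewrite -ge0_integralZl//; last 3 first.
    + apply: emeasurable_funM; first exact/measurable_EFinP.
      by apply/measurable_EFinP; exact: measurable_exponential_pdf.
    + move=> x _; rewrite -EFinM lee_fin mulr_ge0//; first by rewrite invr_ge0 ltW.
      by rewrite exponential_pdf_ge0// invr_ge0 ltW.
    + by rewrite lee_fin mulr_ge0 ?expR_ge0// mulr_ge0// ltW.
    (* Both sides are now integrals over the whole line; for negative [x] the density makes the
       right side vanish too. *)
    rewrite [LHS]integral_mkcond; apply: eq_integral => x _.
    rewrite patchE; case: ifPn => [|]; rewrite ?inE ?notin_setE/= in_itv/= andbT.
      move=> x0; rewrite -!EFinM; congr (_%:E).
      rewrite -[LHS]/(G (F x) * m^-1) exponential_pdfE// /Z ger0_norm// /G /F.
      rewrite opprD expRD mulNr /b.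
      by field; rewrite !gt_eqF//= ltr_wpDl// mulr_ge0// ltW.
    move=> /negP; rewrite -ltNge => x0.
    by rewrite lt0_exponential_pdf// !mule0.
  - by move=> x y _ _ xy; rewrite /F ltrD2r ltr_pM2l ?invr_gt0.
  - by rewrite dF => x _; exact: cst_continuous.
  - by rewrite dF; exact: is_cvg_cst.
  - by rewrite dF; exact: is_cvg_cst.
  - split; first by move=> x _; exact: ex_derive.
    by apply: cvg_at_right_filter; exact: cF.
  - apply: continuous_in_subspaceT => t.
    rewrite F0 inE/= in_itv/= andbT => bt.
    apply: (@continuousM _ R^o (fun t => expR (- t)) GRing.inv).
      by apply: continuous_comp; [exact: continuousN|exact: continuous_expR].
    by apply: inv_continuous; rewrite gt_eqF// (lt_le_trans b0).
  - move=> t; rewrite F0 in_itv/= andbT => bt.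
    by rewrite mulr_ge0 ?expR_ge0// invr_ge0 ltW// (lt_trans b0).
have up : upper_gamma 0 b = expR (- b) * (Pp * m) * fine I.
  rewrite /upper_gamma /Rintegral.
  rewrite (_ : (\int[_]_(t in _) _)%E = (\int[mu]_(t in `[b, +oo[) (G t)%:E)%E).
    by rewrite key fineM//.
  apply: eq_integral => t; rewrite inE/= in_itv/= andbT => bt.
  by rewrite sub0r powR_inv1// (le_trans (ltW b0)).
rewrite -(fineK I_fin); congr (_%:E).
rewrite /c_p -/b up expRN; field.
by rewrite !gt_eqF ?expR_gt0.
Qed.

(** Positivity is read off the mean of [1 / Z] and its explicit lower bound, with no estimate of the
    incomplete gamma function. *)
Lemma c_p_gt0 : 0 < c_p Pp sigma2 m.
Proof.
rewrite -lte_fin -exponential_mean_inv.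
apply: lt_le_trans exponential_mean_inv_ge.
by rewrite lte_fin invr_gt0 addr_gt0// mulr_gt0.
Qed.

End inverse_affine_mean.

Lemma measurable_set_ltr d (T : measurableType d) (R : realType) (f g : T -> R) :
  measurable_fun setT f -> measurable_fun setT g ->
  measurable [set w | f w < g w].
Proof.
move=> mf mg; have := measurable_fun_ltr mf mg.
by move=> /(_ measurableT [set true]); rewrite setTI; exact.
Qed.

Lemma measurable_set_ler d (T : measurableType d) (R : realType) (f g : T -> R) :
  measurable_fun setT f -> measurable_fun setT g ->
  measurable [set w | f w <= g w].
Proof.
move=> mf mg; have := measurable_fun_ler mf mg.
by move=> /(_ measurableT [set true]); rewrite setTI; exact.
Qed.

(** * The SINR distribution for large [Pmax] and its upper tail *)

Section sinr_limit.
Context d (T : measurableType d) (R : realType) (P : probability T R).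
Variables (g h q : {RV P >-> R}) (gbar hbar qbar Q Pp sigma2 : R).
Hypotheses (gbar_gt0 : 0 < gbar) (hbar_gt0 : 0 < hbar) (qbar_gt0 : 0 < qbar)
    (Q_gt0 : 0 < Q) (Pp_gt0 : 0 < Pp) (sigma2_gt0 : 0 < sigma2)
    (g_exp : exponential_with_mean g gbar)
    (h_exp : exponential_with_mean h hbar)
    (q_exp : exponential_with_mean q qbar)
    (ghq_indep : independent3 g h q).

Let Y w := Q * g w / (h w * (Pp * q w + sigma2)).
(* The absolute value makes [Z] positive everywhere, not only almost surely. *)
Let Z (v : R) := Pp * `|v| + sigma2.
Let c := hbar / (Q * gbar).
Let cp := c_p Pp sigma2 qbar.

Let c_gt0 : 0 < c. Proof. by rewrite divr_gt0// mulr_gt0. Qed.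

Let cp_gt0 : 0 < cp. Proof. exact: (c_p_gt0 qbar_gt0 q_exp). Qed.

Let Z_gt0 v : 0 < Z v.
Proof. by rewrite ltr_wpDl// mulr_ge0// ltW. Qed.

Let mZ : measurable_fun setT Z.
Proof. by apply: measurable_funD => //; exact: measurable_funM. Qed.

Let mden : measurable_fun setT (fun w => Pp * q w + sigma2).
Proof. by apply: measurable_funD => //; exact: measurable_funM. Qed.

Let mY : measurable_fun setT Y.
Proof.
apply: measurable_funM; first exact: measurable_funM.
apply: measurableT_comp; first exact: measurable_inv.
exact: measurable_funM.
Qed.

Let msinr Pmax : measurable_fun setT (sinr g h q Q Pmax Pp sigma2).
Proof.
apply: measurable_minr; first exact: mY.
apply: measurable_funM; first exact: measurable_funM.
by apply: measurableT_comp; first exact: measurable_inv.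
Qed.

Let P_le0 (X : {RV P >-> R}) m : 0 < m -> exponential_with_mean X m ->
  P [set w | X w <= 0] = 0%E.
Proof.
by move=> m0 Xm; rewrite (exponential_law_le m0 Xm)// mul0r oppr0 expR0 subrr.
Qed.

(** The order is reversed so that [g] comes last, as [independent3_tail] needs: the tail of [g] is
    taken first, then the integral over [h], then that over [q]. *)
Let qhg_indep : independent3 q h g.
Proof.
move=> A B C mA mB mC; have := ghq_indep mC mB mA.
rewrite [in RHS]muleC [X in _ = (_ * X)%E]muleC muleA => <-.
by rewrite setIC [X in _ `&` X]setIC setIA.
Qed.

Lemma sinr_limit_tail x : 0 < x ->
  P [set w | x < Y w] =
  (\int[distribution P q]_v ((1 + x * c * Z v)^-1)%:E)%E.
Proof.
move=> x0.
(* [phi] is the level that [g] must exceed for [Y > x]. The absolute values keep it nonnegative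
   everywhere, so the exponential tail formula always applies. *)
pose phi (vu : R * R) := x * `|vu.2| * Z vu.1 / Q.
have mphi : measurable_fun setT phi.
  apply: measurable_funM => //; apply: measurable_funM.
    by apply: measurable_funM => //; exact: measurableT_comp.
  exact: measurableT_comp.
have mA : measurable [set w | x < Y w] by exact: measurable_set_ltr.
have mB : measurable [set w | phi (q w, h w) < g w].
  by apply: measurable_set_ltr => //; apply: measurableT_comp => //;
    exact: measurable_funT_pair.
have mh : measurable [set w | h w <= 0] by exact: measurable_set_ler.
have mq : measurable [set w | q w <= 0] by exact: measurable_set_ler.
pose N := [set w | h w <= 0] `|` [set w | q w <= 0].
have mN : measurable N by exact: measurableU.
have PN : P N = 0%E.
  apply/eqP; rewrite eq_le measure_ge0 andbT.
  apply: (le_trans (measureU2 _ mh mq)).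
  by rewrite [X in (X + _)%E](P_le0 hbar_gt0 h_exp)
    [X in (_ + X)%E](P_le0 qbar_gt0 q_exp) adde0.
have AB w : ~ N w -> (x < Y w) = (phi (q w, h w) < g w).
  move=> /not_orP[/negP]; rewrite -ltNge => h0 /negP; rewrite -ltNge => q0.
  rewrite /Y /phi /Z /= !ger0_norm ?ltW//.
  have D0 : 0 < Pp * q w + sigma2 by rewrite addr_gt0// mulr_gt0.
  by rewrite ltr_pdivlMr ?mulr_gt0// ltr_pdivrMr// mulrA [g w * Q]mulrC.
transitivity (P [set w | phi (q w, h w) < g w]).
  (* The two events agree off the null set [N], so each probability is at most the other plus 0. *)
  apply/eqP; rewrite eq_le; apply/andP; split; rewrite -[leRHS]adde0 -PN;
    apply: measure_leU2 => // w;
    have [Nw|/AB wE] := pselect (N w); by [right|left; rewrite /= ?wE// -?wE].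
rewrite (independent3_tail qhg_indep mphi).
apply: eq_integral => v _.
have s0 : 0 <= x * Z v / (Q * gbar).
  by rewrite divr_ge0 ?mulr_ge0 ?ltW.
(* The tail of [g] at [phi (v, u)] is an exponential in the absolute value of [u], so the integral
   over [h] is a Laplace transform at [s = x * Z v / (Q * gbar)], and [s * hbar = x * c * Z v]. *)
transitivity (\int[distribution P h]_u (expR (- (x * Z v / (Q * gbar) * `|u|)))%:E)%E.
  apply: eq_integral => u _.
  rewrite (exponential_law_tail gbar_gt0 g_exp); last first.
    by rewrite /phi/= divr_ge0 ?(ltW Q_gt0)// mulr_ge0 ?(ltW (Z_gt0 v))// mulr_ge0// ltW.
  congr (expR (- _))%:E; rewrite /phi/=; field.
  by rewrite !gt_eqF.
rewrite (exponential_law_laplace hbar_gt0 h_exp s0); congr (_^-1)%:E.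
by rewrite /c; field; rewrite !gt_eqF.
Qed.

Lemma sinr_limit_tail_bounds x : 0 < x ->
  cp / (x * c) - (x * c * sigma2) ^- 2 <= fine (P [set w | x < Y w])
    <= cp / (x * c).
Proof.
move=> x0.
have xc0 : 0 < x * c by rewrite mulr_gt0.
have s0 : 0 < x * c * sigma2 by rewrite mulr_gt0.
have D0 v : 0 < 1 + x * c * Z v by rewrite addr_gt0// mulr_gt0.
have mA : measurable [set w | x < Y w] by exact: measurable_set_ltr.
have Pfin : P [set w | x < Y w] \is a fin_num by exact: fin_num_measure.
have mI : measurable_fun setT (fun v => (1 + x * c * Z v)^-1).
  apply: measurableT_comp; first exact: measurable_inv.
  by apply: measurable_funD => //; exact: measurable_funM.
have mZV : measurable_fun setT (fun v => (Z v)^-1).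
  by apply: measurableT_comp; first exact: measurable_inv.
(* Writing the main term as an integral over the law of [q] lets both bounds be checked pointwise in
   [v]. *)
have KE : ((cp / (x * c))%:E =
    \int[distribution P q]_v ((x * c)^-1 * (Z v)^-1)%:E)%E.
  under eq_integral do rewrite EFinM.
  rewrite ge0_integralZl//.
  - by rewrite (exponential_mean_inv qbar_gt0 q_exp)// -EFinM mulrC.
  - exact/measurable_EFinP.
  - by move=> v _; rewrite lee_fin invr_ge0 ltW.
  - by rewrite lee_fin invr_ge0 ltW.
have mZc : measurable_fun setT (fun v => (x * c)^-1 * (Z v)^-1).
  exact: measurable_funM.
rewrite lerBlDr -!lee_fin EFinD fineK// KE sinr_limit_tail//.
apply/andP; split; last first.
  apply: ge0_le_integral => //.
  - by move=> v _; rewrite lee_fin invr_ge0 ltW.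
  - exact/measurable_EFinP.
  - exact/measurable_EFinP.
  - move=> v _; rewrite lee_fin -invfM lef_pV2 ?posrE//; last exact: mulr_gt0.
    by rewrite lerDr.
have -> : ((x * c * sigma2) ^- 2)%:E =
    (\int[distribution P q]_v ((x * c * sigma2) ^- 2)%:E)%E.
  by rewrite integral_cst//= probability_setT mule1.
rewrite -ge0_integralD//; last 3 first.
- by move=> v _; rewrite lee_fin invr_ge0 ltW.
- exact/measurable_EFinP.
- by move=> v _; rewrite lee_fin invr_ge0 exprn_ge0// ltW.
apply: ge0_le_integral => //.
- by move=> v _; rewrite lee_fin mulr_ge0// invr_ge0 ltW.
- exact/measurable_EFinP.
- by apply: emeasurable_funD => //; exact/measurable_EFinP.
- move=> v _; rewrite -EFinD lee_fin -invfM.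
  set t := x * c * Z v.
  have st : x * c * sigma2 <= t by rewrite ler_pM2l// lerDr mulr_ge0// ltW.
  have t0 := lt_le_trans s0 st.
  (* The first inequality is exact up to the positive remainder [1 / (t^2 (1 + t))]; the second uses
     [t >= x * c * sigma2]. *)
  apply: (@le_trans _ _ ((1 + t)^-1 + t ^- 2)).
    rewrite -subr_ge0 (_ : _ - _ = (t ^+ 2 * (1 + t))^-1); last first.
      by field; rewrite !gt_eqF ?addr_gt0.
    by rewrite invr_ge0 mulr_ge0 ?sqr_ge0// ltW// addr_gt0.
  rewrite lerD2l lef_pV2 ?posrE ?exprn_gt0//.
  by rewrite lerXn2r// nnegrE ltW.
Qed.

Lemma sinr_cdf_cvg x :
  sinr_cdf P g h q Q Pp sigma2 Pmax x @[Pmax --> +oo] -->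
  fine (P [set w | Y w <= x]).
Proof.
(* Since [1 - expR (- s) <= s], the event [h <= Q / M] has probability at most [Q / (M * hbar)],
   which is below [e] beyond this threshold. *)
apply/cvgrPdist_le => e e0; exists (Q / (hbar * e)); split; first exact: num_real.
move=> M QM.
have M0 : 0 < M by apply: le_lt_trans QM; rewrite divr_ge0 ?mulr_ge0 ?ltW.
pose A := [set w | Y w <= x].
pose B := [set w | sinr g h q Q M Pp sigma2 w <= x].
have mA : measurable A by exact: measurable_set_ler.
have mB : measurable B.
  exact: measurable_set_ler.
have mh : measurable [set w | h w <= Q / M] by exact: measurable_set_ler.
have mq : measurable [set w | q w <= 0] by exact: measurable_set_ler.
have mg : measurable [set w | g w <= 0] by exact: measurable_set_ler.
(* Off [N] the factors [g] and [Pp * q + sigma2] are positive and cancel, so the minimum is its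
   first term exactly when [Q / M <= h]. *)
pose N := [set w | h w <= Q / M] `|` ([set w | q w <= 0] `|` [set w | g w <= 0]).
have mN : measurable N by do 2 apply: measurableU => //.
have PN : (P N <= e%:E)%E.
  apply: (le_trans (measureU2 _ mh (measurableU _ _ mq mg))).
  rewrite -[leRHS]adde0; apply: leeD; last first.
    apply: (le_trans (measureU2 _ mq mg)).
    by rewrite [X in (X + _)%E](P_le0 qbar_gt0 q_exp)
      [X in (_ + X)%E](P_le0 gbar_gt0 g_exp) adde0.
  rewrite [leLHS](exponential_law_le hbar_gt0 h_exp); last by rewrite divr_ge0 ?ltW.
  rewrite lee_fin lerBlDr addrC -lerBlDr.
  apply: le_trans (expR_ge1Dx _); rewrite lerD2l lerN2.
  move: QM; rewrite !ltr_pdivrMr ?mulr_gt0// => QM.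
  by rewrite !ler_pdivrMr//; lra.
have AB w : ~ N w -> sinr g h q Q M Pp sigma2 w = Y w.
  move=> /not_orP[/negP]; rewrite -ltNge => h1 /not_orP[/negP + /negP].
  rewrite -!ltNge => q0 g0.
  have h0 : 0 < h w by apply: lt_trans h1; rewrite divr_gt0.
  have D0 : 0 < Pp * q w + sigma2 by rewrite addr_gt0// mulr_gt0.
  rewrite /sinr /Y min_l// invfM mulrA ler_pM2r ?invr_gt0//.
  rewrite ler_pdivrMr// mulrAC ler_pM2r// mulrC -ler_pdivrMr//.
  exact: ltW.
have PAB : (P A <= P B + P N)%E.
  apply: measure_leU2 => // w Yx; have [Nw|/AB wE] := pselect (N w); first by right.
  by left; rewrite /B/= wE.
have PBA : (P B <= P A + P N)%E.
  apply: measure_leU2 => // w Yx; have [Nw|/AB wE] := pselect (N w); first by right.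
  by left; rewrite /A/= -wE.
rewrite /sinr_cdf.
have fA : P A \is a fin_num by exact: fin_num_measure.
have fB : P B \is a fin_num by exact: fin_num_measure.
rewrite ler_distlC -/A -/B lerBlDr -!lee_fin !EFinD !fineK//.
by rewrite (le_trans PAB) ?leeD2l//= (le_trans PBA) ?leeD2l.
Qed.

Lemma sinr_asymptotic_form :
  asymptotic_form (sinr_cdf P g h q Q Pp sigma2)
    (F_IPLR Q Pp sigma2 gbar hbar qbar).
Proof.
exists (fun x => fine (P [set w | Y w <= x])); split; first exact: sinr_cdf_cvg.
(* [k / x] is the error [(x * c * sigma2) ^- 2] divided by the main term [cp / (x * c)]. *)
pose k := (c * sigma2 ^+ 2 * cp)^-1.
apply: (@squeeze_cvgr _ _ _ _ (fun x => 1 - k * x^-1) (cst 1)); last 2 first.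
- rewrite -[X in _ --> X]subr0; apply: cvgB; first exact: cvg_cst.
  rewrite -(mulr0 k); apply: cvgMr.
  apply/gtr0_cvgV0; last exact: cvg_id.
  exact: nbhs_pinfty_gt.
- exact: cvg_cst.
exists 0; split => // x x0.
have mA : measurable [set w | x < Y w] by exact: measurable_set_ltr.
have -> : 1 - fine (P [set w | Y w <= x]) = fine (P [set w | x < Y w]).
  rewrite (_ : [set w | Y w <= x] = ~` [set w | x < Y w]); last first.
    by apply/seteqP; split => w /=; rewrite leNgt => /negP.
  rewrite probability_setC// fineB ?fin_num_measure//=.
  by rewrite opprB addrC subrK.
have -> : 1 - F_IPLR Q Pp sigma2 gbar hbar qbar x = cp / (x * c).
  rewrite /F_IPLR opprB addrC subrK -/cp /c; field.
  by rewrite !gt_eqF.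
have xc0 : 0 < x * c by rewrite mulr_gt0.
have K0 : 0 < cp / (x * c) by rewrite divr_gt0.
have /andP[lo hi] := sinr_limit_tail_bounds x0.
rewrite ler_pdivrMr// mul1r hi andbT ler_pdivlMr//.
rewrite [leLHS](_ : _ = cp / (x * c) - (x * c * sigma2) ^- 2)// /k; field.
by rewrite !gt_eqF.
Qed.

End sinr_limit.

(** * Quantiles and closed forms of the capacities *)

Lemma inf_set_ge (R : realType) (v : R) : inf [set x | v <= x] = v.
Proof.
apply/eqP; rewrite eq_le; apply/andP; split.
- by apply: ge_inf => //=; exists v.
- by apply: lb_le_inf => //; exists v => /=.
Qed.

Section capacities.
Context (R : realType).
Variables (Q Pp sigma2 gbar hbar qbar eps : R).
Hypotheses (hbar_gt0 : 0 < hbar) (eps_gt0 : 0 < eps) (eps_lt1 : eps < 1).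
Let F := F_IPLR Q Pp sigma2 gbar hbar qbar.
Let K := c_p Pp sigma2 qbar * (Q * gbar / hbar).
Hypothesis K_gt0 : 0 < K.

(** For [x > 0], [1 - 1 / y <= 1 - K / x] amounts to [K * y <= x], so the set is a closed half-line.
    The restriction to positive [x] is essential: [F x >= 1] for [x <= 0], which would put every
    such [x] in the set. *)
Lemma quantile_F_IPLR (y : R) : 0 < y ->
  quantile `]0, +oo[ F (1 - y^-1) = K * y.
Proof.
move=> y0; rewrite -[RHS]inf_set_ge; congr inf; apply/seteqP.
have FE x : 0 < x -> (1 - y^-1 <= F x) = (K * y <= x).
  move=> x0; rewrite /F /F_IPLR (_ : _ * (_ / _) = K / x); last first.
    by rewrite /K; field; rewrite !gt_eqF.
  by rewrite lerD2l lerN2 ler_pdivrMr// mulrC ler_pdivlMr.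
split => x /=; rewrite in_itv/= andbT.
  by move=> [x0]; rewrite FE.
move=> Kx; have x0 : 0 < x by apply: lt_le_trans Kx; rewrite mulr_gt0.
by rewrite FE.
Qed.

(** The inequality [eps <= gumbel_cdf a b x] is inverted by taking logarithms twice. The second one
    is legitimate because [eps < 1] gives [ln (1 / eps) > 0], and [0 < b] keeps the direction of the
    inequality. *)
Lemma gumbel_outageE (a b : R) : 0 < b ->
  gumbel_outage a b eps = a - b * ln (ln (1 / eps)).
Proof.
move=> b0; rewrite -[RHS]inf_set_ge; congr inf; apply/seteqP.
have L0 : 0 < ln (1 / eps) by rewrite ln_gt0// ltr_pdivlMr// mul1r.
have gE x : (eps <= gumbel_cdf a b x) = (a - b * ln (ln (1 / eps)) <= x).
  rewrite /gumbel_cdf -[in LHS](lnK eps_gt0) ler_expR lerNr.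
  rewrite -[X in expR _ <= X](_ : ln (1 / eps) = _); last first.
    by rewrite div1r lnV.
  rewrite -[X in expR _ <= X](lnK L0) ler_expR lerNl ler_pdivlMr// mulNr.
  by rewrite lerBrDl mulrC.
by split => x /=; rewrite gE // => -[].
Qed.

Lemma gumbel_location_F_IPLR (N : nat) : (0 < N)%N ->
  gumbel_location F N = ln (1 + K * N%:R).
Proof. by move=> N0; rewrite /gumbel_location quantile_F_IPLR// ltr0n. Qed.

Let factor (N : nat) := ln ((1 + K * N%:R * expR 1) / (1 + K * N%:R)).

Lemma gumbel_scale_F_IPLR (N : nat) : (0 < N)%N -> gumbel_scale F N = factor N.
Proof.
move=> N0; rewrite /gumbel_scale !quantile_F_IPLR ?ltr0n// ?mulrA//.
by rewrite mulr_gt0 ?ltr0n// expR_gt0.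
Qed.

Let KN_gt0 (N : nat) : 0 < 1 + K * N%:R.
Proof. by rewrite ltr_pwDl// mulr_ge0// ltW. Qed.

(** Provides the positive scale that the Gumbel inversion requires; at [N = 0] the factor would be
    [ln 1 = 0]. *)
Lemma factor_gt0 (N : nat) : (0 < N)%N -> 0 < factor N.
Proof.
move=> N0; rewrite ln_gt0// ltr_pdivlMr// mul1r ltrD2l ltr_pMr ?expR_gt1//.
by rewrite mulr_gt0// ltr0n.
Qed.

Lemma C_IPLR_outE (N : nat) : (0 < N)%N ->
  C_IPLR_out Q Pp sigma2 gbar hbar qbar eps N =
  ln (1 + K * N%:R) - factor N * ln (ln (1 / eps)).
Proof.
move=> N0; rewrite /C_IPLR_out gumbel_outageE gumbel_scale_F_IPLR//.
  by rewrite gumbel_location_F_IPLR.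
exact: factor_gt0.
Qed.

Lemma C_IPLRE (N : nat) : (0 < N)%N ->
  C_IPLR Q Pp sigma2 gbar hbar qbar N = ln (1 + K * N%:R) + euler_constant R.
Proof.
by move=> N0; rewrite /C_IPLR /gumbel_mean gumbel_location_F_IPLR// mul1r.
Qed.

End capacities.

(** * Limits as [N] tends to infinity *)

Section limits.
Context (R : realType).
Variable K : R.
Hypothesis K_gt0 : 0 < K.

Lemma cvg_invn : (N%:R^-1 : R) @[N --> \oo] --> (0 : R).
Proof.
apply/gtr0_cvgV0; last exact: cvgr_idn.
by exists 1%N => // N /= N0; rewrite ltr0n.
Qed.

Lemma cvg_inv_lnn : ((ln N%:R)^-1 : R) @[N --> \oo] --> (0 : R).
Proof.
apply/gtr0_cvgV0; first by exists 2%N => // N /= N1; rewrite ln_gt0// ltr1n.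
apply/cvgryPge => A; apply: filterS (nbhs_infty_gtr (expR A)) => N AN.
have N0 : 0 < N%:R :> R by rewrite (lt_trans _ AN)// expR_gt0.
by rewrite -ler_expR lnK// ltW.
Qed.

Lemma cvg_scale_factor :
  ln ((1 + K * N%:R * expR 1) / (1 + K * N%:R)) @[N --> \oo] --> (1 : R).
Proof.
rewrite -[X in _ --> X](expRK (1 : R)).
apply: continuous_cvg; first by apply: continuous_ln; rewrite expR_gt0.
(* Numerator and denominator are divided by [N]. *)
have lim : (N%:R^-1 + K * expR 1) / (N%:R^-1 + K) @[N --> \oo] --> (expR 1 : R).
  rewrite [X in _ --> X](_ : _ = (0 + K * expR 1) / (0 + K)); last first.
    by field; rewrite gt_eqF.
  apply: cvgM; first by apply: cvgD; [exact: cvg_invn|exact: cvg_cst].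
  apply: cvgV; first by rewrite add0r gt_eqF.
  by apply: cvgD; [exact: cvg_invn|exact: cvg_cst].
apply: cvg_trans lim; apply: near_eq_cvg; exists 1%N => // N /= N0.
have N0' : 0 < N%:R :> R by rewrite ltr0n.
have D : 0 < 1 + K * N%:R by rewrite addr_gt0// mulr_gt0.
by field; rewrite !gt_eqF//=.
Qed.

(** Factoring out [N] gives [ln (1 + K * N) = ln N + ln (1 / N + K)], whose second term converges to
    [ln K]. *)
Lemma cvg_ln_affine_ratio :
  ln (1 + K * N%:R) / ln N%:R @[N --> \oo] --> (1 : R).
Proof.
have lim : (1 : R) + ln (N%:R^-1 + K) * (ln N%:R)^-1 @[N --> \oo] --> (1 : R).
  rewrite -[X in _ --> X]addr0 -(mulr0 (ln (0 + K))).
  apply: cvgD; first exact: cvg_cst.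
  apply: cvgM; last exact: cvg_inv_lnn.
  apply: continuous_cvg; first by apply: continuous_ln; rewrite add0r.
  by apply: cvgD; [exact: cvg_invn|exact: cvg_cst].
(* The identity starts at [N = 2], since [ln 1 = 0] cannot be divided out. *)
apply: cvg_trans lim; apply: near_eq_cvg; exists 2%N => // N /= N1.
have N0 : 0 < N%:R :> R by rewrite ltr0n (ltn_trans _ N1).
have L0 : 0 < ln N%:R :> R by rewrite ln_gt0// ltr1n.
have -> : 1 + K * N%:R = N%:R * (N%:R^-1 + K) by field; rewrite gt_eqF.
have S0 : 0 < N%:R^-1 + K by rewrite addr_gt0// invr_gt0.
by rewrite lnM// mulrDl divff// gt_eqF.
Qed.

End limits.

Theorem mainTheorem5 (R : realType) (d : measure_display) (T : measurableType d)
    (P : probability T R) (g h q : {RV P >-> R})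
    (gbar hbar qbar Q Pp sigma2 eps : R)
    (gbar_gt0 : 0 < gbar) (hbar_gt0 : 0 < hbar) (qbar_gt0 : 0 < qbar)
    (Q_gt0 : 0 < Q) (Pp_gt0 : 0 < Pp) (sigma2_gt0 : 0 < sigma2)
    (eps_gt0 : 0 < eps) (eps_lt1 : eps < 1)
    (g_exp : exponential_with_mean g gbar)
    (h_exp : exponential_with_mean h hbar)
    (q_exp : exponential_with_mean q qbar)
    (ghq_indep : independent3 g h q) :
  let F := F_IPLR Q Pp sigma2 gbar hbar qbar in
  let C := C_IPLR Q Pp sigma2 gbar hbar qbar in
  let Cout := C_IPLR_out Q Pp sigma2 gbar hbar qbar eps in
  let K := c_p Pp sigma2 qbar * (Q * gbar / hbar) in
  let E0 := euler_constant R in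
  let loglog := ln (ln (1 / eps)) in
  let factor (N : nat) :=
    ln ((1 + K * N%:R * expR 1) / (1 + K * N%:R)) in
  (* F is the form of the SINR distribution function for Pmax -> +oo *)
  asymptotic_form (sinr_cdf P g h q Q Pp sigma2) F /\
  (* closed form of the asymptotic outage capacity *)
  (forall N : nat, (0 < N)%N ->
     gumbel_scale F N = factor N /\
     Cout N = ln (1 + K * N%:R) - factor N * loglog) /\
  (factor N @[N --> \oo] --> (1 : R)) /\
  (* the approximation, and its expression by the mean capacity *)
  (Cout N - (ln (1 + K * N%:R) - loglog) @[N --> \oo] --> (0 : R)) /\
  (forall N : nat, (0 < N)%N ->
     C N = ln (1 + K * N%:R) + E0 /\
     ln (1 + K * N%:R) - loglog = C N - E0 - loglog) /\
  (* both capacities scale as log N, with an asymptotically constant gap *)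
  (C N / ln (N%:R) @[N --> \oo] --> (1 : R)) /\
  (Cout N / ln (N%:R) @[N --> \oo] --> (1 : R)) /\
  (C N - Cout N @[N --> \oo] --> E0 + loglog).
Proof.
move=> F C Cout K E0 loglog factor.
have K_gt0 : 0 < K.
  apply: mulr_gt0; first exact: c_p_gt0 qbar_gt0 q_exp Pp_gt0 sigma2_gt0.
  by rewrite divr_gt0// mulr_gt0.
have factor_cvg : factor N @[N --> \oo] --> (1 : R) by exact: cvg_scale_factor.
have CE N : (0 < N)%N -> C N = ln (1 + K * N%:R) + E0 by exact: C_IPLRE.
have CoutE N : (0 < N)%N -> Cout N = ln (1 + K * N%:R) - factor N * loglog.
  exact: C_IPLR_outE.
(* Both capacities are [ln (1 + K * N)] plus a convergent sequence: the constant [E0] for the mean,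
   [- (factor N * loglog)] for the outage. One statement thus gives both growth rates. *)
have ratio_cvg (u : nat -> R) (l : R) : u N @[N --> \oo] --> l ->
    (ln (1 + K * N%:R) + u N) / ln N%:R @[N --> \oo] --> (1 : R).
  move=> ul.
  have lim : ln (1 + K * N%:R) / ln N%:R + u N / ln N%:R @[N --> \oo] --> (1 : R).
    rewrite -[X in _ --> X]addr0 -(mulr0 l); apply: cvgD.
      exact: cvg_ln_affine_ratio.
    by apply: cvgM => //; exact: cvg_inv_lnn.
  apply: cvg_trans lim; apply: near_eq_cvg.
  by exists 0%N => // N _ /=; rewrite mulrDl.
have factor_loglog_cvg : factor N * loglog @[N --> \oo] --> loglog.
  by rewrite -[X in _ --> X]mul1r; apply: cvgMl.
split; first exact: sinr_asymptotic_form.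
split.
  by move=> N N0; split; [exact: gumbel_scale_F_IPLR|exact: CoutE].
split; first exact: factor_cvg.
split.
  have lim : loglog - factor N * loglog @[N --> \oo] --> (0 : R).
    by rewrite -[X in _ --> X](subrr loglog); apply: cvgB => //; exact: cvg_cst.
  (* The closed forms hold from [N = 1] on, which suffices for the limit. *)
  apply: cvg_trans lim; apply: near_eq_cvg; exists 1%N => // N /= N0.
  by rewrite CoutE//; ring.
split; first by move=> N N0; rewrite CE//; split=> //; ring.
split.
  have lim : (ln (1 + K * N%:R) + E0) / ln N%:R @[N --> \oo] --> (1 : R).
    exact: (ratio_cvg (fun=> E0) E0 (cvg_cst _)).
  apply: cvg_trans lim; apply: near_eq_cvg; exists 1%N => // N /= N0.
  by rewrite CE.
split.
  have lim : (ln (1 + K * N%:R) - factor N * loglog) / ln N%:R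
      @[N --> \oo] --> (1 : R).
    exact: (ratio_cvg (fun N => - (factor N * loglog)) _ (cvgN factor_loglog_cvg)).
  apply: cvg_trans lim; apply: near_eq_cvg; exists 1%N => // N /= N0.
  by rewrite CoutE.
have lim : E0 + factor N * loglog @[N --> \oo] --> E0 + loglog.
  by apply: cvgD => //; exact: cvg_cst.
apply: cvg_trans lim; apply: near_eq_cvg; exists 1%N => // N /= N0.
by rewrite CE// CoutE//; ring.
Qed.
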